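(* Let $E$ be an order complete vector lattice. Then every abstract integral operator $T$ on $E$ satisfies $\mathcal P_E(T)=\mathcal P_A(T)$.
   Context: $\mathcal L_r(E)$ is the order complete vector lattice of regular operators on $E$ (differences of positive operators). $E_n^\sim$ is the order continuous dual of $E$ (order continuous, order bounded linear functionals), and $E\otimes E_n^\sim$ is the space of finite sums of rank-one operators $x\otimes\varphi\colon y\mapsto\varphi(y)x$ with $x\in E$, $\varphi\in E_n^\sim$. An abstract integral operator on $E$ is an element of the band generated by $E\otimes E_n^\sim$ in $\mathcal L_r(E)$. $\mathrm{Orth}(E)$ is the set of orthomorphisms of $E$ (order bounded operators leaving every band of $E$ invariant); it is a projection band in $\mathcal L_r(E)$, namely the band generated by the identity operator. $\mathcal P_E$ denotes the band projection of $\mathcal L_r(E)$ onto $\mathrm{Orth}(E)$; $\mathcal P_E(T)$ is called the diagonal of $T$. For a band $B$ of $E$ with band projection $P_B$, $\mathcal P_B(T)$ denotes the diagonal, in the order complete vector lattice $B$, of the compression $P_BTP_B$, regarded as an operator on $E$ that is zero on $B^d$. An atom of $E$ is a non-zero positive vector $a$ such that $0\le x,y\le a$ and $x\perp y$ imply $x=0$ or $y=0$. $A$ denotes the atomic part of $E$, i.e. the band generated by all atoms of $E$; $\mathcal P_A(T)$ is called the atomic diagonal of $T$. *)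

(* Defs.v *)
From HB Require Import structures.
From mathcomp Require Import all_boot all_order all_algebra.
From mathcomp Require Import all_classical all_reals.

Set Implicit Arguments.
Unset Strict Implicit.
Unset Printing Implicit Defensive.

Import Order.TTheory GRing.Theory Num.Theory.

Local Open Scope classical_set_scope.
Local Open Scope ring_scope.

(* The lattice operations are fields of this mixin, not an Order.Lattice
   instance: Hierarchy Builder accepts no join of Order.Lattice ring_display
   and GRing.Zmodule declared after Num.RealDomain. *)
HB.mixin Record isVectorLattice (R : realType) (E : Type)
    of GRing.Lmodule R E & Num.POrderedZmodule E := {
  vjoin : E -> E -> E ;
  vmeet : E -> E -> E ;
  levD2l : forall z x y : E, x <= y -> z + x <= z + y ;
  scalev_ge0 : forall (a : R) (x : E), 0 <= a -> 0 <= x -> 0 <= a *: x ;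
  vjoinP : forall x y z : E, (vjoin x y <= z) = (x <= z) && (y <= z) ;
  vmeetP : forall x y z : E, (z <= vmeet x y) = (z <= x) && (z <= y)
}.

#[short(type="vectorLatticeType")]
HB.structure Definition VectorLattice (R : realType) :=
  { E of GRing.Lmodule R E & Num.POrderedZmodule E & isVectorLattice R E }.

HB.mixin Record isOrderComplete (R : realType) (E : Type)
    of VectorLattice R E := {
  order_complete : forall A : set E, has_sup A -> supremums A !=set0
}.

#[short(type="completeVectorLatticeType")]
HB.structure Definition CompleteVectorLattice (R : realType) :=
  { E of VectorLattice R E & isOrderComplete R E }.

Section real_line.
Variable R : realType.

HB.instance Definition _ := Num.POrderedZmodule.on R^o.

Let levD2l_real (z x y : R^o) : x <= y -> z + x <= z + y.
Proof. by move=> xy; exact: (@lerD R _ _ _ _ (lexx z) xy). Qed.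

Let scalev_ge0_real (a : R) (x : R^o) : 0 <= a -> 0 <= x -> 0 <= a *: x.
Proof. exact: (@mulr_ge0 R). Qed.

Let joinP_real (x y z : R^o) :
  (Num.max (x : R) y <= z) = (x <= z) && (y <= z).
Proof. exact: (@ge_max _ R). Qed.

Let meetP_real (x y z : R^o) :
  (z <= Num.min (x : R) y) = (z <= x) && (z <= y).
Proof. exact: (@le_min _ R). Qed.

HB.instance Definition _ :=
  isVectorLattice.Build R R^o levD2l_real scalev_ge0_real joinP_real meetP_real.

Let order_complete_real (A : set R^o) : has_sup A -> supremums A !=set0.
Proof.
move=> sA; exists (reals.sup (A : set R)).
split=> [x Ax|y Ay]; first exact: (@sup_upper_bound R A sA).
by apply: (@ge_sup R A) => //; case: sA.
Qed.

HB.instance Definition _ := isOrderComplete.Build R R^o order_complete_real.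
End real_line.

Section vector_lattice.
Variables (R : realType) (E : vectorLatticeType R).
Implicit Types (x y z u v : E) (A B D : set E).

Definition absv x : E := vjoin x (- x).

Definition vdisjoint x y : Prop := vmeet (absv x) (absv y) = 0.

Definition disjoint_complement B : set E :=
  [set x | forall y, B y -> vdisjoint x y].

Definition order_ideal B : Prop :=
  [/\ B 0,
      forall (a : R) x y, B x -> B y -> B (a *: x + y)
    & forall x y, B y -> absv x <= absv y -> B x].

Definition is_band B : Prop :=
  order_ideal B /\ (forall D s, D `<=` B -> supremums D s -> B s).

Record band := Band { carrier : set E; bandP : is_band carrier }.

Lemma generated_band_subproof D :
  is_band [set x | forall B : band, D `<=` carrier B -> carrier B x].
Proof.
split; first split.
- by move=> B _; have [[]] := bandP B.
- move=> a x y xP yP B DB; have [[_ lB _] _] := bandP B.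
  by apply: lB; [exact: xP | exact: yP].
- move=> x y yP xy B DB; have [[_ _ sB] _] := bandP B.
  by apply: sB xy; exact: yP.
- move=> D' s D'P D's B DB; have [_ supB] := bandP B.
  by apply: supB D's => x /D'P; exact.
Qed.

Definition generated_band D : band := Band (generated_band_subproof D).

Definition atom (a : E) : Prop :=
  [/\ a != 0, 0 <= a
    & forall x y, 0 <= x <= a -> 0 <= y <= a -> vdisjoint x y ->
        x = 0 \/ y = 0].

Definition atomic_part : band := generated_band atom.

Lemma levD x y u v : x <= y -> u <= v -> x + u <= y + v.
Proof.
move=> xy uv; apply: (le_trans (levD2l x _ _ uv)).
by rewrite ![_ + v]addrC; exact: levD2l.
Qed.

Lemma subv_ge0 x y : (0 <= y - x) = (x <= y).
Proof.
apply/idP/idP => [/(levD2l x)|/(levD2l (- x))].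
  by rewrite addr0 addrC subrK.
by rewrite addNr addrC.
Qed.

Lemma addv_ge0 x y : 0 <= x -> 0 <= y -> 0 <= x + y.
Proof. by move=> x0 y0; rewrite -[0]addr0; exact: levD. Qed.

Lemma levN2 x y : (- x <= - y) = (y <= x).
Proof. by rewrite -[LHS]subv_ge0 opprK addrC subv_ge0. Qed.

Lemma levBlDr x y z : (x - y <= z) = (x <= z + y).
Proof. by rewrite -[LHS]subv_ge0 -[RHS]subv_ge0 opprB addrA addrAC. Qed.

Lemma levBrDr x y z : (x <= y - z) = (x + z <= y).
Proof. by rewrite -[LHS]subv_ge0 -[RHS]subv_ge0 opprD addrA addrAC. Qed.

Lemma levZ2 (a : R) x y : 0 <= a -> x <= y -> a *: x <= a *: y.
Proof.
by move=> a0 xy; rewrite -subv_ge0 -scalerBr scalev_ge0 // subv_ge0.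
Qed.

Lemma lev_joinl x y : x <= vjoin x y.
Proof. by have := lexx (vjoin x y); rewrite vjoinP => /andP[]. Qed.

Lemma lev_joinr x y : y <= vjoin x y.
Proof. by have := lexx (vjoin x y); rewrite vjoinP => /andP[]. Qed.

Lemma lev_meetl x y : vmeet x y <= x.
Proof. by have := lexx (vmeet x y); rewrite vmeetP => /andP[]. Qed.

Lemma lev_meetr x y : vmeet x y <= y.
Proof. by have := lexx (vmeet x y); rewrite vmeetP => /andP[]. Qed.

Lemma absvN x : absv (- x) = absv x.
Proof.
by apply: le_anti; rewrite /absv !vjoinP opprK !(lev_joinl, lev_joinr).
Qed.

Lemma absv_ge0 x : 0 <= absv x.
Proof.
have h : 0 <= absv x + absv x.
  by rewrite -[0](subrr x); apply: levD; rewrite (lev_joinl, lev_joinr).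
have h2 : (2^-1 : R) *: (absv x + absv x) = absv x.
  by rewrite -mulr2n -scaler_nat scalerA mulVf ?pnatr_eq0// scale1r.
by rewrite -h2 scalev_ge0 // invr_ge0 ler0n.
Qed.

Lemma ler_absv x : x <= absv x. Proof. exact: lev_joinl. Qed.

Lemma ger0_absv x : 0 <= x -> absv x = x.
Proof.
move=> x0; apply: le_anti; rewrite lev_joinl vjoinP lexx /= andbT.
by apply: (le_trans _ x0); rewrite -oppr0 levN2.
Qed.

Lemma absv0 : absv 0 = 0. Proof. exact: ger0_absv. Qed.

Lemma absv_eq0 x : absv x <= 0 -> x = 0.
Proof.
move=> h; apply: le_anti; rewrite (le_trans (ler_absv x) h) /=.
by rewrite -levN2 oppr0; apply: (le_trans _ h); exact: lev_joinr.
Qed.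

Lemma absvD x y : absv (x + y) <= absv x + absv y.
Proof.
by rewrite vjoinP opprD !levD // (lev_joinl, lev_joinr).
Qed.

Lemma vmeetC x y : vmeet x y = vmeet y x.
Proof. by apply: le_anti; rewrite !vmeetP !(lev_meetl, lev_meetr). Qed.

Lemma vmeet_ge0 x y : 0 <= x -> 0 <= y -> 0 <= vmeet x y.
Proof. by move=> x0 y0; rewrite vmeetP x0. Qed.

Lemma le_vmeet x y u v : x <= u -> y <= v -> vmeet x y <= vmeet u v.
Proof.
move=> xu yv; rewrite vmeetP (le_trans (lev_meetl _ _) xu) /=.
exact: le_trans (lev_meetr _ _) yv.
Qed.

Definition vpos x := vjoin x 0.
Definition vneg x := vjoin (- x) 0.

Lemma vpos_ge0 x : 0 <= vpos x. Proof. exact: lev_joinr. Qed.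
Lemma vneg_ge0 x : 0 <= vneg x. Proof. exact: lev_joinr. Qed.

Lemma vposBneg x : x = vpos x - vneg x.
Proof.
suff -> : vneg x = vpos x - x by rewrite opprB addrC subrK.
apply: le_anti; rewrite vjoinP subv_ge0 lev_joinl andbT.
rewrite levBrDr addNr lev_joinr /= levBlDr vjoinP.
by rewrite -levBlDr subrr lev_joinr -levBlDr sub0r lev_joinl.
Qed.

Lemma riesz_decomposition z x y : 0 <= z -> 0 <= x -> 0 <= y -> z <= x + y ->
  exists u v, [/\ z = u + v, 0 <= u <= x & 0 <= v <= y].
Proof.
move=> z0 x0 y0 zxy; exists (vmeet z x), (z - vmeet z x); split.
- by rewrite addrC subrK.
- by rewrite vmeet_ge0 //= lev_meetr.
- rewrite subv_ge0 lev_meetl /= levBlDr addrC -levBlDr vmeetP.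
  rewrite !levBlDr zxy andbT -[X in X <= _]addr0; exact: levD2l.
Qed.

Lemma vmeetDl_le x y z : 0 <= x -> 0 <= y -> 0 <= z ->
  vmeet (x + y) z <= vmeet x z + vmeet y z.
Proof.
move=> x0 y0 z0; set w := vmeet _ z.
have w0 : 0 <= w by rewrite vmeet_ge0 // addv_ge0.
have wz : w <= z by exact: lev_meetr.
have [u [v [wE /andP[u0 ux] /andP[v0 vy]]]] :=
  riesz_decomposition w0 x0 y0 (lev_meetl _ _).
rewrite wE levD // vmeetP ?ux ?vy /= (le_trans _ wz) // wE.
  by rewrite -[X in X <= _]addr0; exact: levD2l.
by rewrite -[X in X <= _]add0r; apply: levD.
Qed.

Lemma vmeetZ (a : R) x y : 0 < a -> vmeet (a *: x) (a *: y) = a *: vmeet x y.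
Proof.
move=> a0; have aV : a *: (a^-1 *: vmeet (a *: x) (a *: y)) = vmeet (a *: x) (a *: y).
  by rewrite scalerA mulfV ?gt_eqF // scale1r.
have Va z : a^-1 *: (a *: z) = z by rewrite scalerA mulVf ?gt_eqF // scale1r.
apply/le_anti/andP; split.
  rewrite -[X in X <= _]aV; apply: levZ2; first exact: ltW.
  rewrite vmeetP.
  rewrite -[X in (_ <= X) && _]Va -[X in _ && (_ <= X)]Va.
  have aV0 : 0 <= a^-1 by rewrite invr_ge0 ltW.
  by rewrite !(levZ2 aV0) ?lev_meetl ?lev_meetr.
by rewrite vmeetP !(levZ2 (ltW a0)) ?lev_meetl ?lev_meetr.
Qed.

Lemma absvZ_le (a : R) x : absv (a *: x) <= `|a| *: absv x.
Proof.
have h (b : R) : 0 <= b -> absv (b *: x) <= b *: absv x.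
  by move=> b0; rewrite vjoinP -scalerN !(levZ2 b0) ?lev_joinl ?lev_joinr.
have [a0|a0] := leP 0 a; first by rewrite ger0_norm // h.
by rewrite ltr0_norm // -absvN -scaleNr h // oppr_ge0 ltW.
Qed.

Lemma disjointC x y : vdisjoint x y -> vdisjoint y x.
Proof. by rewrite /vdisjoint vmeetC. Qed.

Lemma le_disjoint x y z : absv x <= absv y -> vdisjoint y z -> vdisjoint x z.
Proof.
move=> xy yz; apply: le_anti; rewrite vmeet_ge0 ?absv_ge0 // andbT.
by rewrite -yz le_vmeet.
Qed.

Lemma disjointD x y z : vdisjoint x z -> vdisjoint y z -> vdisjoint (x + y) z.
Proof.
move=> xz yz; apply: le_anti; rewrite vmeet_ge0 ?absv_ge0 // andbT.
apply: (le_trans (le_vmeet (absvD x y) (lexx _))).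
apply: (le_trans (vmeetDl_le _ _ _)); rewrite ?absv_ge0 //.
by rewrite xz yz addr0.
Qed.

Lemma disjointZ (a : R) x z : vdisjoint x z -> vdisjoint (a *: x) z.
Proof.
move=> xz; apply: le_anti; rewrite vmeet_ge0 ?absv_ge0 // andbT.
pose b := `|a| + 1; have b0 : 0 < b by rewrite ltr_wpDl.
have b1 : 1 <= b by rewrite lerDr.
have xb : absv (a *: x) <= b *: absv x.
  apply: (le_trans (absvZ_le a x)); rewrite scalerDl scale1r.
  by rewrite -[X in X <= _]addr0; apply: levD2l; exact: absv_ge0.
have zb : absv z <= b *: absv z.
  rewrite scalerDl scale1r -[X in X <= _]add0r; apply: levD => //.
  by rewrite scalev_ge0 ?absv_ge0.
by apply: (le_trans (le_vmeet xb zb)); rewrite vmeetZ // xz scaler0.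
Qed.

Lemma disjoint_self x : vdisjoint x x -> x = 0.
Proof. by move=> xx; apply: absv_eq0; rewrite -xx vmeetP lexx. Qed.

Lemma disjoint_complement_linear B (a : R) x y :
  disjoint_complement B x -> disjoint_complement B y ->
  disjoint_complement B (a *: x + y).
Proof.
by move=> xB yB z Bz; apply: disjointD; [apply/disjointZ/xB | exact: yB].
Qed.

End vector_lattice.
Arguments band {R} E.
Arguments atomic_part {R} E.

Section order_complete.
Variables (R : realType) (E : completeVectorLatticeType R).
Implicit Types (x y z : E) (A B : set E).

Definition vsup A : E := supremum 0 A.

Lemma vsupP A : has_sup A -> supremums A (vsup A).
Proof.
move=> sA; rewrite /vsup /supremum.
case: ifPn => [/eqP A0|_]; first by move: sA; rewrite A0 => /has_sup0.
by case: xgetP => // /(_ _ _) h; have [s /h] := order_complete _ sA.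
Qed.

Variable B : band E.

Lemma band_decomposition x : exists y,
  carrier B y /\ disjoint_complement (carrier B) (x - y).
Proof.
have [[B0 Blin Bsol] Bsup] := bandP B.
have pos z : 0 <= z -> exists y,
    carrier B y /\ disjoint_complement (carrier B) (z - y).
  move=> z0; pose A : set E := [set b | carrier B b /\ b <= z].
  have sA : has_sup A by split; [exists 0 | exists z => b []].
  have [ubA lubA] := vsupP sA.
  have By : carrier B (vsup A) by apply: (Bsup A); [move=> b [] | exact: vsupP].
  have yz : vsup A <= z by apply: lubA => b [].
  exists (vsup A); split => // b Bb.
  rewrite /vdisjoint ger0_absv ?subv_ge0 //; set w := vmeet _ _.
  have w0 : 0 <= w by rewrite vmeet_ge0 ?absv_ge0 // subv_ge0.
  have Bw : carrier B w.
    by apply: Bsol Bb _; rewrite (ger0_absv w0) lev_meetr.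
  apply: le_anti; rewrite w0 andbT.
  have : w + vsup A <= vsup A.
    apply: ubA; split; first by rewrite -[w]scale1r; exact: Blin.
    by rewrite -levBrDr lev_meetl.
  by rewrite -levBrDr subrr.
have [y [By dy]] := pos _ (vpos_ge0 x).
have [y' [By' dy']] := pos _ (vneg_ge0 x).
exists (- 1 *: y' + y); split; first exact: Blin.
rewrite {1}[x]vposBneg.
rewrite (_ : _ - _ = -1 *: (vneg x - y') + (vpos x - y)).
  exact: disjoint_complement_linear.
by rewrite !scaleN1r !opprD !opprK [in RHS]addrACA [- vneg x + _]addrC.
Qed.

(* The unique y in B with x - y in B^d; it exists by band_decomposition. *)
Definition band_proj x : E :=
  xget 0 [set y | carrier B y /\ disjoint_complement (carrier B) (x - y)].

Lemma band_projP x :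
  carrier B (band_proj x) /\
  disjoint_complement (carrier B) (x - band_proj x).
Proof.
by rewrite /band_proj; case: xgetP => // h; have [y /h] := band_decomposition x.
Qed.

Lemma band_proj_unique x y :
  carrier B y -> disjoint_complement (carrier B) (x - y) -> band_proj x = y.
Proof.
move=> By dy; have [Bp dp] := band_projP x.
have [[_ Blin _] _] := bandP B.
apply/eqP; rewrite -subr_eq0; apply/eqP/disjoint_self.
suff : disjoint_complement (carrier B) (band_proj x - y).
  by apply; rewrite addrC -scaleN1r; exact: Blin.
rewrite (_ : _ - _ = -1 *: (x - band_proj x) + (x - y)).
  exact: disjoint_complement_linear.
by rewrite scaleN1r opprB addrA subrK.
Qed.

Lemma band_proj_linear : linear band_proj.
Proof.
move=> a x y; have [[_ Blin _] _] := bandP B.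
have [Bx dx] := band_projP x; have [By dy] := band_projP y.
apply: band_proj_unique; first exact: Blin.
rewrite (_ : _ - _ = a *: (x - band_proj x) + (y - band_proj y)).
  exact: disjoint_complement_linear.
by rewrite scalerBr opprD addrACA.
Qed.

HB.instance Definition _ :=
  GRing.isLinear.Build R E E *:%R band_proj band_proj_linear.

Lemma band_proj_id x : carrier B x -> band_proj x = x.
Proof.
move=> Bx; apply: band_proj_unique => // y By.
apply: le_anti; rewrite subrr /vdisjoint absv0 vmeet_ge0 ?absv_ge0 // andbT.
exact: lev_meetl.
Qed.

Lemma band_proj_ge0 x : 0 <= x -> 0 <= band_proj x.
Proof.
move=> x0; have [Bp dp] := band_projP x; have [[_ _ Bsol] _] := bandP B.
set p := band_proj x in Bp dp *.
suff n0 : vneg p = 0 by rewrite [p]vposBneg n0 subr0 vpos_ge0.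
have np : vneg p <= absv p by rewrite vjoinP lev_joinr absv_ge0.
have Bn : carrier B (vneg p) by apply: Bsol Bp _; rewrite ger0_absv ?vneg_ge0.
apply: disjoint_self; apply: (@le_disjoint _ _ _ (x - p)); last exact: dp.
rewrite (ger0_absv (vneg_ge0 _)) vjoinP absv_ge0 andbT.
apply: (le_trans _ (ler_absv _)); rewrite -[X in X <= _]add0r.
by apply: levD.
Qed.

End order_complete.

Section operators.
Variables (R : realType) (E F : vectorLatticeType R).

Definition positive_operator (T : {linear E -> F}) : Prop :=
  forall x, 0 <= x -> 0 <= T x.

Definition is_regular (T : E -> F) : Prop :=
  exists T1 T2 : {linear E -> F},
    [/\ positive_operator T1, positive_operator T2 & forall x, T x = T1 x - T2 x].

Definition order_bounded (T : E -> F) : Prop :=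
  forall a b, exists c d, forall x, a <= x <= b -> c <= T x <= d.

Definition regular_pred : {pred E -> F} := fun T => `[< is_regular T >].

Lemma regular_submod_closed : submod_closed regular_pred.
Proof.
split; first by apply/asboolP; exists \0, \0; split => // x; rewrite subrr.
move=> a T S /asboolP[T1 [T2 [T1p T2p TE]]] /asboolP[S1 [S2 [S1p S2p SE]]].
apply/asboolP; have [a0|/ltW a0] := leP 0 a.
  exists ((a \*: T1) \+ S1), ((a \*: T2) \+ S2); split.
  - by move=> x x0 /=; apply: addv_ge0; [apply: scalev_ge0 => //; exact: T1p | exact: S1p].
  - by move=> x x0 /=; apply: addv_ge0; [apply: scalev_ge0 => //; exact: T2p | exact: S2p].
  - move=> x; change (a *: T x + S x = (a *: T1 x + S1 x) - (a *: T2 x + S2 x)).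
    by rewrite TE SE scalerBr opprD addrACA.
exists ((- a \*: T2) \+ S1), ((- a \*: T1) \+ S2).
rewrite -oppr_ge0 in a0; split.
- by move=> x x0 /=; apply: addv_ge0; [apply: scalev_ge0 => //; exact: T2p | exact: S1p].
- by move=> x x0 /=; apply: addv_ge0; [apply: scalev_ge0 => //; exact: T1p | exact: S2p].
- move=> x.
  change (a *: T x + S x = (- a *: T2 x + S1 x) - (- a *: T1 x + S2 x)).
  by rewrite TE SE scalerBr !scaleNr opprD opprK [in RHS]addrACA [- _ + _ in RHS]addrC.
Qed.

HB.instance Definition _ :=
  GRing.isSubmodClosed.Build R (E -> F) regular_pred regular_submod_closed.

(* regop E E is L_r(E). *)
Record regop := Regop { regop_fun :> E -> F; _ : regop_fun \in regular_pred }.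

HB.instance Definition _ := [isSub for regop_fun].
HB.instance Definition _ := [Choice of regop by <:].
HB.instance Definition _ := [SubChoice_isSubLmodule of regop by <:].

Lemma regopP (T : regop) : is_regular T.
Proof. by case: T => T /= /asboolP. Qed.

Lemma regop_linear (T : regop) : linear T.
Proof.
have [T1 [T2 [_ _ TE]]] := regopP T; move=> a x y.
by rewrite !TE (linearP T1) (linearP T2) scalerBr opprD addrACA.
Qed.

HB.instance Definition _ (T : regop) :=
  GRing.isLinear.Build R E F *:%R (regop_fun T) (regop_linear T).

Lemma regopD (T S : regop) x : (T + S) x = T x + S x. Proof. by []. Qed.
Lemma regopN (T : regop) x : (- T) x = - T x. Proof. by []. Qed.
Lemma regopZ (a : R) (T : regop) x : (a *: T) x = a *: T x. Proof. by []. Qed.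
Lemma regop0 x : (0 : regop) x = 0. Proof. by []. Qed.

Lemma eq_regop (T S : regop) : (forall x, 0 <= x -> T x = S x) -> T = S.
Proof.
move=> TS; apply/val_inj/funext => x /=.
have UE (U : regop) : U x = U (vpos x) - U (vneg x).
  by rewrite -linearB -vposBneg.
by rewrite !UE !TS ?vpos_ge0 ?vneg_ge0.
Qed.

(* T <= S iff S - T is a positive operator. *)
Definition regop_le (T S : regop) : bool :=
  `[< forall x, 0 <= x -> T x <= S x >].

Let regop_le_refl : reflexive regop_le.
Proof. by move=> T; apply/asboolP. Qed.

Let regop_le_anti : antisymmetric regop_le.
Proof.
move=> T S /andP[/asboolP TS /asboolP ST].
by apply: eq_regop => x x0; apply: le_anti; rewrite TS ?ST.
Qed.

Let regop_le_trans : transitive regop_le.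
Proof.
move=> S T U /asboolP TS /asboolP SU; apply/asboolP => x x0.
exact: le_trans (TS x x0) (SU x x0).
Qed.

HB.instance Definition _ := Order.Le_isPOrder.Build ring_display regop
  regop_le_refl regop_le_anti regop_le_trans.

Lemma regop_leP (T S : regop) :
  reflect (forall x, 0 <= x -> T x <= S x) (T <= S).
Proof. exact: asboolP. Qed.

Lemma regop_incr (T : regop) x y : 0 <= T -> x <= y -> T x <= T y.
Proof.
move=> /regop_leP T0 xy; rewrite -subv_ge0 -linearB.
by apply: T0; rewrite subv_ge0.
Qed.

Lemma pos_regopP (T : {linear E -> F}) : positive_operator T ->
  (T : E -> F) \in regular_pred.
Proof.
move=> Tp; apply/asboolP; exists T, \0; split => // x.
by rewrite /= subr0.
Qed.

Lemma regop_order_bounded (T : regop) : order_bounded T.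
Proof.
have [T1 [T2 [T1p T2p TE]]] := regopP T; move=> a b.
have incr (S : {linear E -> F}) x y :
    positive_operator S -> x <= y -> S x <= S y.
  by move=> Sp xy; rewrite -subv_ge0 -linearB; apply: Sp; rewrite subv_ge0.
exists (T1 a - T2 b), (T1 b - T2 a) => x /andP[ax xb].
by rewrite TE !levD ?levN2 ?incr.
Qed.

End operators.

Section riesz_kantorovich.
Variables (R : realType) (E : vectorLatticeType R).
Variable F : completeVectorLatticeType R.
Local Notation L := (regop E F).
Implicit Types (D : set L) (T S U : L) (x y : E) (z : F).

(* pieces D x z: z is a sum of T_i x_i with T_i in D, x_i >= 0 of sum x. *)
Inductive pieces D : E -> F -> Prop :=
| pieces0 : pieces D 0 0
| piecesS x z T u : pieces D x z -> D T -> 0 <= u -> pieces D (x + u) (z + T u).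

Lemma pieces_ge0 D x z : pieces D x z -> 0 <= x.
Proof. by elim=> // {}x {}z T u _ x0 _ u0; exact: addv_ge0. Qed.

Lemma pieces1 D T x : D T -> 0 <= x -> pieces D x (T x).
Proof.
move=> DT x0; rewrite -[x]add0r linearD linear0.
exact: piecesS (pieces0 D) DT x0.
Qed.

Lemma piecesD D x y z w :
  pieces D x z -> pieces D y w -> pieces D (x + y) (z + w).
Proof.
move=> xz; elim=> [|y' w' T u _ IH DT u0]; first by rewrite !addr0.
by rewrite !addrA; exact: piecesS.
Qed.

Lemma piecesZ D (a : R) x z : 0 <= a -> pieces D x z -> pieces D (a *: x) (a *: z).
Proof.
move=> a0; elim=> [|x' z' T u _ IH DT u0]; first by rewrite !scaler0; exact: pieces0.
by rewrite !scalerDr -linearZ; apply: piecesS => //; exact: scalev_ge0.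
Qed.

Lemma pieces_split D v z : pieces D v z -> forall x y, 0 <= x -> 0 <= y ->
  v = x + y -> exists z1 z2, [/\ z = z1 + z2, pieces D x z1 & pieces D y z2].
Proof.
elim=> [|v' z' T u vz IH DT u0] x y x0 y0.
  move=> xy; exists 0, 0; rewrite addr0.
  have -> : x = 0.
    by apply: le_anti; rewrite x0 andbT xy -[X in X <= _]addr0 levD2l.
  have -> : y = 0.
    by apply: le_anti; rewrite y0 andbT xy -[X in X <= _]add0r levD.
  by split => //; exact: pieces0.
move=> vxy.
have uxy : u <= x + y.
  rewrite -vxy -[X in X <= _]add0r; apply: levD => //; exact: pieces_ge0 vz.
have [u1 [u2 [uE /andP[u10 u1x] /andP[u20 u2y]]]] :=
  riesz_decomposition u0 x0 y0 uxy.
have x1 : 0 <= x - u1 by rewrite subv_ge0.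
have y2 : 0 <= y - u2 by rewrite subv_ge0.
have vE : v' = (x - u1) + (y - u2) by rewrite addrACA -opprD -uE -vxy addrK.
have [z1 [z2 [zE p1 p2]]] := IH _ _ x1 y2 vE.
exists (z1 + T u1), (z2 + T u2); split.
- by rewrite zE uE linearD addrACA.
- by rewrite -[x](subrK u1); exact: piecesS.
- by rewrite -[y](subrK u2); exact: piecesS.
Qed.

Lemma pieces_le D U x z : ubound D U -> pieces D x z -> z <= U x.
Proof.
move=> DU; elim=> [|x' z' T u _ IH DT u0]; first by rewrite linear0.
by rewrite linearD levD //; have /regop_leP := DU _ DT; exact.
Qed.

Section sup.
Variable D : set L.
Hypothesis sD : has_sup D.

Let g x : F := vsup (pieces D x).

Let gP x : 0 <= x -> supremums (pieces D x) (g x).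
Proof.
move=> x0; apply: vsupP; have [[T DT] [U DU]] := sD; split.
  by exists (T x); exact: pieces1.
by exists (U x) => z; exact: pieces_le.
Qed.

Let g_ub x z : pieces D x z -> z <= g x.
Proof. by move=> h; have [ub _] := gP (pieces_ge0 h); exact: ub. Qed.

Let gD x y : 0 <= x -> 0 <= y -> g (x + y) = g x + g y.
Proof.
move=> x0 y0; apply: le_anti; apply/andP; split.
  have [_ lub] := gP (addv_ge0 x0 y0).
  apply: lub => z /pieces_split /(_ x y x0 y0 erefl)[z1 [z2 [-> p1 p2]]].
  by apply: levD; exact: g_ub.
rewrite -[g y](opprK) -/(_ - _) levBlDr.
have [_ lub] := gP x0; apply: lub => z p1.
rewrite -levBlDr opprK addrC -[z]opprK -/(_ - _) levBlDr.
have [_ luby] := gP y0; apply: luby => w p2.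
by rewrite -levBlDr opprK addrC; apply/g_ub/piecesD.
Qed.

Let gZ_le (a : R) x : 0 < a -> 0 <= x -> a *: g x <= g (a *: x).
Proof.
move=> a0 x0; rewrite -[g (a *: x)]scale1r -(mulfV (lt0r_neq0 a0)) -scalerA.
apply: levZ2; first exact: ltW.
have [_ lub] := gP x0; apply: lub => z p.
have zE : z = a^-1 *: (a *: z) by rewrite scalerA mulVf ?scale1r // lt0r_neq0.
rewrite zE; apply: levZ2; first by rewrite invr_ge0 ltW.
by apply: g_ub; apply: piecesZ => //; exact: ltW.
Qed.

Let gZ (a : R) x : 0 < a -> 0 <= x -> g (a *: x) = a *: g x.
Proof.
move=> a0 x0; apply: le_anti; rewrite gZ_le // andbT.
have aV : a *: (a^-1 *: g (a *: x)) = g (a *: x).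
  by rewrite scalerA mulfV ?scale1r // lt0r_neq0.
rewrite -[X in X <= _]aV; apply: levZ2; first exact: ltW.
have xE : x = a^-1 *: (a *: x) by rewrite scalerA mulVf ?scale1r // lt0r_neq0.
rewrite {2}xE; apply: gZ_le; first by rewrite invr_gt0.
by apply: scalev_ge0 => //; exact: ltW.
Qed.

Let f x : F := g (vpos x) - g (vneg x).

Let fE x u v : 0 <= u -> 0 <= v -> x = u - v -> f x = g u - g v.
Proof.
move=> u0 v0 xE; have px := vpos_ge0 x; have nx := vneg_ge0 x.
have e : vpos x + v = u + vneg x.
  apply/eqP; rewrite -subr_eq -addrA; apply/eqP.
  by rewrite [v - _]addrC addrA -vposBneg xE subrK.
have := congr1 g e; rewrite !gD // => h.
by rewrite /f; apply/eqP; rewrite subr_eq addrAC -h addrK.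
Qed.

Let f_linear : linear f.
Proof.
have fN x : f (- x) = - f x.
  rewrite (@fE (- x) (vneg x) (vpos x)) ?vpos_ge0 ?vneg_ge0 //.
    by rewrite /f opprB.
  by rewrite {1}[x]vposBneg opprB.
have fD x y : f (x + y) = f x + f y.
  rewrite (@fE (x + y) (vpos x + vpos y) (vneg x + vneg y)).
  - by rewrite !gD ?vpos_ge0 ?vneg_ge0 // /f opprD addrACA.
  - by rewrite addv_ge0 ?vpos_ge0.
  - by rewrite addv_ge0 ?vneg_ge0.
  - by rewrite opprD addrACA -!vposBneg.
have fZp (a : R) x : 0 < a -> f (a *: x) = a *: f x.
  move=> a0; rewrite (@fE (a *: x) (a *: vpos x) (a *: vneg x)).
  - by rewrite !gZ ?vpos_ge0 ?vneg_ge0 // /f scalerBr.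
  - by rewrite scalev_ge0 ?vpos_ge0 // ltW.
  - by rewrite scalev_ge0 ?vneg_ge0 // ltW.
  - by rewrite -scalerBr -vposBneg.
move=> a x y; rewrite fD; congr (_ + _).
have [a0|a0|->] := ltgtP a 0; last 1 first.
- rewrite !scale0r; apply: (@addrI _ (f 0)); by rewrite -fD !addr0.
- by rewrite -[a]opprK (scaleNr (- a) x) fN fZp ?oppr_gt0 // -scaleNr.
- exact: fZp.
Qed.

Let f_pos x : 0 <= x -> f x = g x.
Proof.
move=> x0; rewrite (@fE x x 0) ?subr0 //.
have g0 : g 0 = 0 by apply: (@addrI _ (g 0)); rewrite -gD // !addr0.
by rewrite g0 subr0.
Qed.

Let f_regular : f \in @regular_pred R E F.
Proof.
have [[T DT] _] := sD.
have [T1 [T2 [T1p T2p TE]]] := regopP T.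
have lS : linear (fun x => f x - T1 x + T2 x).
  move=> a x y; have fl := f_linear a x y.
  rewrite fl (linearP T1) (linearP T2); move: (f x) (f y) => p q.
  rewrite !scalerDr scalerN opprD (addrACA (a *: p)).
  exact: addrACA.
pose S : {linear E -> F} := HB.pack (fun x => f x - T1 x + T2 x)
  (GRing.isLinear.Build R E F *:%R _ lS).
apply/asboolP; exists (S \+ T1), T2; split => //.
  move=> x x0 /=; apply: addv_ge0; last exact: T1p.
  rewrite -addrA [- _ + _]addrC -opprB -TE subv_ge0 f_pos //.
  by apply: g_ub; exact: pieces1.
by move=> x /=; rewrite [f x - _ + _]addrAC subrK addrK.
Qed.

Lemma riesz_kantorovich : exists S : L, supremums D S /\
  forall x, 0 <= x -> supremums (pieces D x) (S x).
Proof.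
exists (Regop f_regular); split; last first.
  by move=> x x0; rewrite /= f_pos //; exact: gP.
split=> [T DT|U DU]; apply/regop_leP => x x0 /=; rewrite f_pos //.
  by apply: g_ub; exact: pieces1.
by have [_ lub] := gP x0; apply: lub => z; exact: pieces_le.
Qed.

End sup.

Lemma regop_sup D S x : supremums D S -> D !=set0 -> 0 <= x ->
  supremums (pieces D x) (S x).
Proof.
move=> DS D0 x0; have sD : has_sup D by split=> //; exists S; case: DS.
have [S' [DS' S'P]] := riesz_kantorovich sD.
by rewrite (is_subset1_supremums DS DS'); exact: S'P.
Qed.

Let has_sup2 T S : has_sup [set T; S].
Proof.
split; first by exists T; left.
have [T1 [T2 [T1p T2p TE]]] := regopP T.
have [S1 [S2 [S1p S2p SE]]] := regopP S.
exists (Regop (pos_regopP T1p) + Regop (pos_regopP S1p)).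
have ineq (a b c : F) : 0 <= b -> 0 <= c -> a - b <= a + c.
  move=> b0 c0; apply: levD2l; apply: (le_trans _ c0).
  by rewrite -oppr0 levN2.
move=> U [->|->]; apply/regop_leP => x x0; rewrite regopD /= ?TE ?SE.
  by apply: ineq; [exact: T2p | exact: S1p].
by rewrite addrC [T1 x + _]addrC -[- S2 x + _]addrC; apply: ineq; [exact: S2p | exact: T1p].
Qed.

Let regop_join T S : L := supremum 0 [set T; S].
Let regop_meet T S : L := - regop_join (- T) (- S).

Let regop_levN2 T S : (- T <= - S) = (S <= T).
Proof.
apply/regop_leP/regop_leP => h x x0; have := h x x0;
  by rewrite !regopN levN2.
Qed.

Let regop_joinP T S U : (regop_join T S <= U) = (T <= U) && (S <= U).
Proof.
have [ub lub] : supremums [set T; S] (regop_join T S).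
  rewrite /regop_join /supremum; case: ifPn => [/eqP e|_].
    by have h : [set T; S] T := or_introl erefl; rewrite e in h.
  have [V [VP _]] := riesz_kantorovich (has_sup2 T S).
  by case: xgetP => // h; have := h V VP.
apply/idP/andP => [h|[TU SU]]; last by apply: lub => V [->|->].
have T_ := ub T (or_introl erefl); have S_ := ub S (or_intror erefl).
by split; [exact: le_trans T_ h | exact: le_trans S_ h].
Qed.

Let regop_meetP T S U : (U <= regop_meet T S) = (U <= T) && (U <= S).
Proof. by rewrite -{1}[U]opprK regop_levN2 regop_joinP !regop_levN2. Qed.

Let regop_levD2l (U T S : L) : T <= S -> U + T <= U + S.
Proof.
move=> /regop_leP TS; apply/regop_leP => x x0.
by rewrite !regopD; apply/levD2l/TS.
Qed.

Let regop_scalev_ge0 (a : R) T : 0 <= a -> 0 <= T -> 0 <= a *: T.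
Proof.
move=> a0 /regop_leP T0; apply/regop_leP => x x0.
by rewrite regopZ; apply: scalev_ge0 => //; exact: T0.
Qed.

HB.instance Definition _ := isVectorLattice.Build R L
  regop_levD2l regop_scalev_ge0 regop_joinP regop_meetP.

Let regop_complete D : has_sup D -> supremums D !=set0.
Proof. by move=> /riesz_kantorovich[S [DS _]]; exists S. Qed.

HB.instance Definition _ := isOrderComplete.Build R L regop_complete.

End riesz_kantorovich.

Section orthomorphisms.
Variables (R : realType) (E : completeVectorLatticeType R).
Local Notation L := (regop E E).
Implicit Types (T S : L) (x y : E) (B : band E) (D : set L).

Definition orthomorphism T : Prop :=
  order_bounded T /\ (forall B x, carrier B x -> carrier B (T x)).

Let orthomorphism_pos T :
  (forall B x, 0 <= x -> carrier B x -> carrier B (T x)) -> orthomorphism T.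
Proof.
move=> h; split; first exact: regop_order_bounded.
move=> B x Bx; have [[_ Blin Bsol] _] := bandP B.
rewrite [x]vposBneg linearB addrC -scaleN1r; apply: Blin.
  apply: h; first exact: vneg_ge0.
  by apply: Bsol Bx _; rewrite ger0_absv ?vneg_ge0 // vjoinP lev_joinr absv_ge0.
apply: h; first exact: vpos_ge0.
by apply: Bsol Bx _; rewrite ger0_absv ?vpos_ge0 // vjoinP lev_joinl absv_ge0.
Qed.

Let carrier_le B x y : carrier B y -> 0 <= x -> x <= y -> carrier B x.
Proof.
move=> By x0 xy; have [[_ _ Bsol] _] := bandP B; apply: Bsol By _.
by rewrite !ger0_absv // (le_trans x0).
Qed.

Let orthomorphism0 : orthomorphism 0.
Proof.
by apply: orthomorphism_pos => B x _ _; rewrite regop0; have [[]] := bandP B.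
Qed.

Let orthomorphism_sup D S :
  D `<=` orthomorphism -> supremums D S -> orthomorphism S.
Proof.
move=> DO DS; have [D0|/set0P D0] := eqVneq D set0.
  have [_ lub] := DS; have minS U : S <= U by apply: lub; rewrite D0.
  suff -> : S = 0 by exact: orthomorphism0.
  apply: le_anti; rewrite minS /=; have := minS (S + S).
  by rewrite -levBlDr subrr.
apply: orthomorphism_pos => B x x0 Bx; have [[B0 Blin _] Bsup] := bandP B.
apply: (Bsup (pieces D x)); last exact: regop_sup.
move=> z xz; elim: xz Bx {x0} => // {}x {}z T u xz IH DT u0 Bxu.
have x0 := pieces_ge0 xz.
rewrite -[z]scale1r; apply: Blin.
  apply/IH/(carrier_le Bxu) => //.
  by rewrite -[X in X <= _]addr0; exact: levD2l.
have [_ TB] := DO _ DT; apply/TB/(carrier_le Bxu) => //.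
by rewrite -[X in X <= _]add0r; exact: levD.
Qed.

Lemma orthomorphism_band : is_band [set T | orthomorphism T].
Proof.
split; [split|exact: orthomorphism_sup] => //=.
- move=> a T S [_ TB] [_ SB]; apply: orthomorphism_pos => B x _ Bx.
  rewrite regopD regopZ; have [[_ Blin _] _] := bandP B.
  by apply: Blin; [exact: TB | exact: SB].
- move=> S T TO ST.
  have [_ aTB] : orthomorphism (absv T).
    apply: (@orthomorphism_sup [set T; - T]).
      move=> _ [->//|->]; apply: orthomorphism_pos => B x _ Bx.
      have [_ TB] := TO; have [[B0 Blin _] _] := bandP B.
      by rewrite regopN -scaleN1r -[_ *: _]addr0; apply: Blin => //; exact: TB.
    split=> [_ [->|->]|U ub]; [exact: lev_joinl|exact: lev_joinr|].
    by rewrite vjoinP !ub //; [right | left].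
  apply: orthomorphism_pos => B x x0 Bx; have [[_ _ Bsol] _] := bandP B.
  apply: Bsol (aTB B x Bx) _.
  apply: (le_trans _ (ler_absv _)); rewrite vjoinP -regopN.
  apply/andP; split; apply/regop_leP => //; apply: (le_trans _ ST).
    exact: lev_joinl.
  exact: lev_joinr.
Qed.

Definition Orth : band L := Band orthomorphism_band.

Definition op_diagonal : L -> L := band_proj Orth.

End orthomorphisms.
Arguments Orth {R} E.

Section band_lattice.
Variables (R : realType) (E : completeVectorLatticeType R) (B : band E).

Definition band_pred : {pred E} := fun x => `[< carrier B x >].

Lemma band_predP x : reflect (carrier B x) (x \in band_pred).
Proof. exact: asboolP. Qed.

Let band_submod_closed : submod_closed band_pred.
Proof.
have [[B0 Blin _] _] := bandP B; split; first exact/band_predP.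
by move=> a x y /band_predP Bx /band_predP By; apply/band_predP/Blin.
Qed.

HB.instance Definition _ :=
  GRing.isSubmodClosed.Build R E band_pred band_submod_closed.

Record band_type := BandElt { band_val : E; _ : band_val \in band_pred }.

HB.instance Definition _ := [isSub for band_val].
HB.instance Definition _ := [Choice of band_type by <:].
HB.instance Definition _ := [SubChoice_isSubLmodule of band_type by <:].
HB.instance Definition _ :=
  [SubChoice_isSubPOrder of band_type by <: with ring_display].

Implicit Types b c d : band_type.

Lemma carrier_val b : carrier B (val b).
Proof. by case: b => b /= /band_predP. Qed.

Lemma lev_val b c : (b <= c) = (val b <= val c).
Proof. by rewrite -Order.le_val. Qed.

Definition to_band x (Bx : carrier B x) : band_type :=
  BandElt (introT (band_predP x) Bx).

Let joinB b c : carrier B (vjoin (val b) (val c)).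
Proof.
have [_ Bsup] := bandP B; apply: (Bsup [set val b; val c]).
  by move=> _ [->|->]; exact: carrier_val.
split; first by move=> _ [->|->]; [exact: lev_joinl | exact: lev_joinr].
by move=> u ub; rewrite vjoinP !ub //; [right | left].
Qed.

Let band_join b c := to_band (joinB b c).
Let band_meet b c := - band_join (- b) (- c).

Let levN_val b c : (- b <= - c) = (c <= b).
Proof. by rewrite !lev_val !raddfN /= levN2. Qed.

Let band_joinP b c d : (band_join b c <= d) = (b <= d) && (c <= d).
Proof. by rewrite !lev_val vjoinP. Qed.

Let band_meetP b c d : (d <= band_meet b c) = (d <= b) && (d <= c).
Proof. by rewrite -{1}[d]opprK levN_val band_joinP !levN_val. Qed.

Let band_levD2l b c d : c <= d -> b + c <= b + d.
Proof. by rewrite !lev_val !raddfD /= => cd; exact: levD2l. Qed.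

Let band_scalev_ge0 (a : R) b : 0 <= a -> 0 <= b -> 0 <= a *: b.
Proof.
by move=> a0; rewrite !lev_val raddf0 linearZ /= => b0; exact: scalev_ge0.
Qed.

HB.instance Definition _ := isVectorLattice.Build R band_type
  band_levD2l band_scalev_ge0 band_joinP band_meetP.

Let band_order_complete (A : set band_type) : has_sup A -> supremums A !=set0.
Proof.
move=> [[b Ab] [c cA]].
have sA : has_sup [set val d | d in A].
  split; first by exists (val b), b.
  by exists (val c) => _ [d Ad <-]; rewrite -lev_val; exact: cA.
have [s [ub lub]] := order_complete _ sA.
have Bs : carrier B s.
  have [_ Bsup] := bandP B; apply: (Bsup [set val d | d in A]) => //.
  by move=> _ [d _ <-]; exact: carrier_val.
exists (to_band Bs); split=> [d Ad|d ubd]; rewrite lev_val /=.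
  by apply: ub; exists d.
by apply: lub => _ [d' Ad' <-]; rewrite -lev_val; exact: ubd.
Qed.

HB.instance Definition _ :=
  isOrderComplete.Build R band_type band_order_complete.

Definition to_band_proj x : band_type := to_band (band_projP B x).1.

Lemma to_band_projE x : val (to_band_proj x) = band_proj B x.
Proof. by []. Qed.

Let to_band_proj_linear : linear to_band_proj.
Proof. by move=> a x y; apply: val_inj; rewrite /= linearP. Qed.

HB.instance Definition _ :=
  GRing.isLinear.Build R E band_type *:%R to_band_proj to_band_proj_linear.

Lemma to_band_proj_ge0 x : 0 <= x -> 0 <= to_band_proj x.
Proof. by move=> x0; rewrite lev_val; exact: band_proj_ge0. Qed.

Let compression_regular (T : regop E E) :
  (fun b => to_band_proj (T (val b))) \in @regular_pred R band_type band_type.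
Proof.
have [T1 [T2 [T1p T2p TE]]] := regopP T.
apply/asboolP; exists (to_band_proj \o T1 \o val), (to_band_proj \o T2 \o val).
split=> [b b0|b b0|b] /=.
- by apply/to_band_proj_ge0/T1p; rewrite lev_val in b0.
- by apply/to_band_proj_ge0/T2p; rewrite lev_val in b0.
- by rewrite TE linearB.
Qed.

(* The restriction of P_B T P_B to B, as an operator on the vector lattice B. *)
Definition compression (T : regop E E) : regop band_type band_type :=
  Regop (compression_regular T).

Let extension_regular (S : regop band_type band_type) :
  (fun x => val (S (to_band_proj x))) \in @regular_pred R E E.
Proof.
have [S1 [S2 [S1p S2p SE]]] := regopP S.
apply/asboolP; exists (val \o S1 \o to_band_proj), (val \o S2 \o to_band_proj).
split=> [x x0|x x0|x] /=.
- by have := S1p _ (to_band_proj_ge0 x0); rewrite lev_val.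
- by have := S2p _ (to_band_proj_ge0 x0); rewrite lev_val.
- by rewrite SE; exact: (raddfB val).
Qed.

(* Since to_band_proj x is P_B x, extension S is S on B and zero on B^d. *)
Definition extension (S : regop band_type band_type) : regop E E :=
  Regop (extension_regular S).

Definition band_diagonal (T : regop E E) : regop E E :=
  extension (op_diagonal (compression T)).

End band_lattice.

Section abstract_integral_operators.
Variables (R : realType).

Definition directed (I : Type) (le : I -> I -> Prop) : Prop :=
  [/\ exists i : I, True,
      forall i, le i i,
      forall i j k, le i j -> le j k -> le i k
    & forall i j, exists k, le i k /\ le j k].

(* x converges in order to l if it is dominated, over the same index set, by a
   net decreasing to 0. *)
Definition order_cvg (E : vectorLatticeType R) (I : Type)
    (le : I -> I -> Prop) (x : I -> E) (l : E) : Prop :=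
  exists y : I -> E,
    [/\ forall i j, le i j -> y j <= y i,
        infimums (range y) 0
      & forall i, absv (x i - l) <= y i].

(* Continuity at 0 only: meant for linear T. *)
Definition order_continuous (E F : vectorLatticeType R) (T : E -> F) : Prop :=
  forall (I : Type) (le : I -> I -> Prop) (x : I -> E), directed le ->
    order_cvg le x 0 -> order_cvg le (fun i => T (x i)) 0.

Definition order_continuous_dual (E : vectorLatticeType R)
    (phi : {linear E -> R^o}) : Prop :=
  order_bounded phi /\ order_continuous phi.

Variable E : completeVectorLatticeType R.

(* The tensor product of E and E_n^~: finite sums of rank-one operators. *)
Definition tensor_oc_dual : set (regop E E) := [set T |
  exists (n : nat) (x : 'I_n -> E) (phi : 'I_n -> {linear E -> R^o}),
    (forall i, order_continuous_dual (phi i)) /\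
    (forall y, T y = \sum_(i < n) phi i y *: x i)].

Definition abstract_integral_operator (T : regop E E) : Prop :=
  carrier (generated_band tensor_oc_dual) T.

End abstract_integral_operators.

(* Main.v *)
Require Import Defs.
From mathcomp Require Import all_boot all_order all_algebra.
From mathcomp Require Import all_classical all_reals.

(** Write A for the atomic part, P for the band projection onto A and D for the
    diagonal of T.

    The compression to a band commutes with taking the diagonal
    ([op_diagonal_compression]): if V is positive then P V P <= V, so compressing
    an operator disjoint from Orth(E) leaves it disjoint from Orth(A).  Hence the
    atomic diagonal of T is P D P, and since D commutes with P it remains to see
    that D vanishes on the disjoint complement of A
    ([op_diagonal_off_atomic]).

    Let H be the set of positive orthomorphisms that vanish on A.  The disjoint
    complement of H is a band of L_r(E); once it contains the tensor product of E
    and E_n^~, it contains T.  Then |D| (I - P), a member of H below |D|, is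
    disjoint from T and from T - D, hence from D, hence from itself, so it is
    zero.

    The heart of the matter is therefore that a finite sum of rank-one operators
    is disjoint from H.  If W in H lies below the modulus of such a sum, then
    W y <= psi(y) X for all y >= 0, where X is a fixed positive vector and psi is a
    positive superadditive function, a sum of moduli of functionals.  Let
    u >= 0 be disjoint from A and suppose that W u is not zero.  The space being
    Archimedean, some e > 0 makes r = (W u - e X)^+ non-zero.  On a non-zero band
    C' of the band generated by r the bound W u <= e X fails, and
    W (P_C' u) <= psi(P_C' u) X, so psi(P_C' u) > e.  Two disjoint non-zero bands
    therefore cost more than 2 e of psi, and repeated splitting of the component
    of u must stop, at an atom below u ([atom_below]); but u is disjoint from all
    atoms. *)

Set Implicit Arguments.
Unset Strict Implicit.
Unset Printing Implicit Defensive.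

Import Order.TTheory GRing.Theory Num.Theory.

Local Open Scope classical_set_scope.
Local Open Scope ring_scope.

(** * Disjoint complements and generated bands *)

Section vector_lattice.
Variables (R : realType) (E : vectorLatticeType R).
Implicit Types (x y z s : E) (B D : set E).

Lemma absv_absv x : absv (absv x) = absv x.
Proof. by apply/ger0_absv/absv_ge0. Qed.

Lemma disjoint0v x : vdisjoint 0 x.
Proof.
apply: le_anti; rewrite absv0 vmeet_ge0 ?absv_ge0 // andbT.
exact: lev_meetl.
Qed.

(** Subtracting the meet m of x^+ and x^- from x^+ leaves an upper bound of x
    and 0. *)
Lemma disjoint_posneg x : vdisjoint (vpos x) (vneg x).
Proof.
rewrite /vdisjoint !ger0_absv ?vpos_ge0 ?vneg_ge0 //.
set m := vmeet _ _; have m0 : 0 <= m by rewrite vmeet_ge0 ?vpos_ge0 ?vneg_ge0.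
apply: le_anti; rewrite m0 andbT.
have : vpos x <= vpos x - m.
  rewrite {1}/vpos vjoinP subv_ge0 lev_meetl andbT levBrDr.
  rewrite {1}[x]vposBneg addrAC levBlDr; apply: levD2l.
  exact: lev_meetr.
by rewrite levBrDr addrC -levBrDr subrr.
Qed.

(** The sum of disjoint positive vectors is their join. *)
Lemma addv_le_disjoint x y s : vmeet x y = 0 -> x <= s -> y <= s -> x + y <= s.
Proof.
move=> xy xs ys; rewrite -[s]add0r -levBlDr -xy vmeetP.
by rewrite !levBlDr; apply/andP; split; [|rewrite addrC]; exact: levD2l.
Qed.

(** A supremum of the empty set is a least vector, and only the zero vector
    space has one. *)
Lemma supremums_set0 s : supremums set0 s -> s = 0.
Proof.
move=> [_ lub]; have bot z : s <= z by apply: lub.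
by apply: le_anti; rewrite bot /=; have := bot (s + s); rewrite -levBlDr subrr.
Qed.

(** Closure under suprema: let s be the supremum of D, and w the part of s, after
    a translation that makes it positive, below |b|.  Each element of D is
    disjoint from w, so it stays below s - w; thus s <= s - w. *)
Lemma disjoint_complement_band B : is_band (disjoint_complement B).
Proof.
split; first split.
- by move=> y _; exact: disjoint0v.
- exact: disjoint_complement_linear.
- by move=> x y yB xy b Bb; apply: le_disjoint xy _; exact: yB.
move=> D s DB sD b Bb.
have [D0|/set0P[d0 Dd0]] := eqVneq D set0.
  by move: sD; rewrite D0 => /supremums_set0 ->; exact: disjoint0v.
have [ub lub] := sD.
(* Translating by d0 makes the supremum positive. *)
rewrite -[s](subrK d0); apply: disjointD; last exact: DB.
have s0 : 0 <= s - d0 by rewrite subv_ge0 ub.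
rewrite /vdisjoint (ger0_absv s0); set w := vmeet _ _.
have w0 : 0 <= w by rewrite vmeet_ge0 ?absv_ge0.
apply: le_anti; rewrite w0 andbT.
suff : s <= s - w by rewrite levBrDr addrC -levBrDr subrr.
apply: lub => d Dd; rewrite levBrDr -[d](subrK d0) addrAC -levBrDr.
have pw : vmeet (vpos (d - d0)) w = 0.
  have db : vdisjoint (d - d0) b.
    rewrite -scaleN1r addrC.
    by apply: disjointD; [apply: disjointZ|]; exact: DB.
  apply: le_anti; rewrite vmeet_ge0 ?vpos_ge0 // andbT -db.
  apply: le_vmeet; last exact: lev_meetr.
  by rewrite vjoinP ler_absv absv_ge0.
apply: le_trans (addv_le_disjoint pw _ (lev_meetl _ _)).
  by rewrite addrC [_ + w]addrC; apply/levD2l/lev_joinl.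
rewrite vjoinP s0 andbT addrC [s - _]addrC; apply: levD2l; exact: ub.
Qed.

Definition complement_band B : band E := Band (disjoint_complement_band B).

Lemma sub_generated_band D (C : band E) :
  D `<=` carrier C -> carrier (generated_band D) `<=` carrier C.
Proof. by move=> DC x; exact. Qed.

Lemma mem_generated_band D : D `<=` carrier (generated_band D).
Proof. by move=> x Dx C DC; exact: DC. Qed.

Lemma generated_band_disjoint x y z :
  vdisjoint x y -> carrier (generated_band [set x]) z -> vdisjoint z y.
Proof.
move=> xy xz.
have sub : [set x] `<=` carrier (complement_band [set y]) by move=> _ -> _ ->.
by apply: (sub_generated_band sub xz).
Qed.

End vector_lattice.

(** * Band projections *)

Section band_projections.
Variables (R : realType) (E : completeVectorLatticeType R).
Implicit Types (x y w X : E) (C : band E).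

(** If s is the supremum of the multiples of w, then s - w is also an upper
    bound of them. *)
Lemma archimedean w X : 0 <= X ->
  (forall e : R, 0 < e -> w <= e *: X) -> w <= 0.
Proof.
move=> X0 wX; pose A := [set w *+ n | n in [set: nat]].
have sA : has_sup A.
  split; first by exists (w *+ 0), 0%N.
  exists X => _ [n _ <-].
  case: n => [|n]; first by rewrite mulr0n.
  have n0 : (0 : R) < n.+1%:R by rewrite ltr0n.
  have nV0 : (0 : R) < n.+1%:R^-1 by rewrite invr_gt0.
  have := levZ2 (ltW n0) (wX _ nV0).
  by rewrite scalerA mulfV ?gt_eqF // scale1r scaler_nat.
have [ub lub] := vsupP sA.
have : vsup A <= vsup A - w.
  by apply: lub => _ [n _ <-]; rewrite levBrDr -mulrSr; apply: ub; exists n.+1.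
by rewrite levBrDr addrC -levBrDr subrr.
Qed.

Lemma band_proj_complement C x :
  band_proj (complement_band (carrier C)) x = x - band_proj C x.
Proof.
have [Cp dp] := band_projP C x.
apply: band_proj_unique => //.
by rewrite opprB addrC subrK => y yC; apply/disjointC/yC.
Qed.

Lemma band_proj_eq0 C x :
  disjoint_complement (carrier C) x -> band_proj C x = 0.
Proof.
move=> dx; apply: band_proj_unique; last by rewrite subr0.
by have [[]] := bandP C.
Qed.

Lemma band_proj_le C x : 0 <= x -> band_proj C x <= x.
Proof.
by move=> x0; rewrite -subv_ge0 -band_proj_complement band_proj_ge0.
Qed.

Lemma band_proj_incr C x y : x <= y -> band_proj C x <= band_proj C y.
Proof.
by move=> xy; rewrite -subv_ge0 -linearB band_proj_ge0 // subv_ge0.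
Qed.

Lemma absv_band_proj C x : absv (band_proj C x) <= absv x.
Proof.
apply: (le_trans _ (band_proj_le C (absv_ge0 x))).
rewrite vjoinP -linearN !band_proj_incr ?ler_absv //; exact: lev_joinr.
Qed.

Lemma orth_band_proj (W : regop E E) C x : orthomorphism W ->
  W (band_proj C x) = band_proj C (W x).
Proof.
move=> [_ WB]; have [Cp dp] := band_projP C x.
apply/esym/band_proj_unique; first exact: WB.
by rewrite -linearB; exact: (WB (complement_band (carrier C))).
Qed.

End band_projections.

(** * Orthomorphisms dominated by a superadditive function *)

Section domination.
Variables (R : realType) (E : completeVectorLatticeType R).
Implicit Types (x y u X : E) (C : band E).

Variables (psi : E -> R).
Hypothesis psi_ge0 : forall x, 0 <= x -> 0 <= psi x.
Hypothesis psi_superadd :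
  forall x y, 0 <= x -> 0 <= y -> psi x + psi y <= psi (x + y).

Let psi_incr x y : 0 <= x -> x <= y -> psi x <= psi y.
Proof.
move=> x0 xy; rewrite -[y](subrK x) addrC.
have yx0 : 0 <= y - x by rewrite subv_ge0.
apply: le_trans (psi_superadd x0 yx0); rewrite lerDl; exact: psi_ge0.
Qed.

Let psi0_le0 : psi 0 <= 0.
Proof.
by have := psi_superadd (lexx 0) (lexx 0); rewrite addr0 gerDl.
Qed.

(** The component of u in C is an atom, or it dominates two disjoint non-zero
    vectors x and y.  The bands that x and y generate both use more than e of
    psi, so passing from C to the band of x lowers psi of the component by at
    least e, which can happen only finitely often. *)
Lemma atom_below (e : R) u C : 0 < e -> 0 <= u ->
  (exists2 x, carrier C x & x != 0) ->
  (forall C', carrier C' `<=` carrier C -> (exists2 x, carrier C' x & x != 0) ->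
    e < psi (band_proj C' u)) ->
  exists2 a, atom a & a <= u.
Proof.
move=> e0 u0 Cn0 Ce.
have [n nP] : exists n : nat, psi (band_proj C u) <= n%:R * e.
  exists (Num.truncn (psi (band_proj C u) / e)).+1.
  by rewrite -ler_pdivrMr // ltW // truncnS_gt.
elim: n C Cn0 Ce nP => [|n IH] C Cn0 Ce nP.
  have := Ce C (@subset_refl _ _) Cn0; rewrite ltNge.
  by rewrite (le_trans nP) // mul0r ltW.
set c := band_proj C u in nP.
have c0 : 0 <= c by exact: band_proj_ge0.
have cu : c <= u by exact: band_proj_le.
have [ac|nac] := pselect (atom c); first by exists c.
have cn0 : c != 0.
  apply/eqP => cE; have := Ce C (@subset_refl _ _) Cn0.
  by rewrite -/c cE ltNge (le_trans psi0_le0) // ltW.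
have [x [y [x0c y0c xy xn0 yn0]]] : exists x y,
    [/\ 0 <= x <= c, 0 <= y <= c, vdisjoint x y, x != 0 & y != 0].
  apply: contrapT => h; apply: nac; split => // x y x0c y0c xy.
  have [->|xn0] := eqVneq x 0; first by left.
  have [->|yn0] := eqVneq y 0; first by right.
  by exfalso; apply: h; exists x, y.
have [Cc _] := band_projP C u.
have [[_ _ Csol] _] := bandP C.
have inC z : 0 <= z <= c -> carrier C z.
  move=> /andP[z0 zc]; apply: (Csol _ c) => //.
  by rewrite !ger0_absv.
have subC z : 0 <= z <= c -> carrier (generated_band [set z]) `<=` carrier C.
  by move=> zc; apply: sub_generated_band => _ ->; exact: inC.
pose C1 := generated_band [set x]; pose C2 := generated_band [set y].
have C1C : carrier C1 `<=` carrier C by exact: subC.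
have C2C : carrier C2 `<=` carrier C by exact: subC.
have C1n0 : exists2 x, carrier C1 x & x != 0.
  by exists x => //; exact: mem_generated_band.
have C2n0 : exists2 x, carrier C2 x & x != 0.
  by exists y => //; exact: mem_generated_band.
have C12 z : carrier C1 z -> disjoint_complement (carrier C2) z.
  move=> C1z t C2t; apply: generated_band_disjoint C1z; apply: disjointC.
  by apply: generated_band_disjoint C2t; exact: disjointC.
apply: (IH C1) => //.
  by move=> C' C'C1; apply: Ce => z /C'C1 /C1C.
set c1 := band_proj C1 u; set c2 := band_proj C2 u.
have c10 : 0 <= c1 by exact: band_proj_ge0.
have c20 : 0 <= c2 by exact: band_proj_ge0.
have c12 : c1 + c2 <= c.
  have proj_c C' : carrier C' `<=` carrier C -> band_proj C' u <= c.
    move=> C'C; rewrite -(band_proj_id (C'C _ (band_projP C' u).1)).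
    by apply/band_proj_incr/band_proj_le.
  apply: addv_le_disjoint; [|exact: proj_c..].
  have := C12 _ (band_projP C1 u).1 _ (band_projP C2 u).1.
  by rewrite /vdisjoint !ger0_absv.
have := le_trans (psi_superadd c10 c20) (psi_incr (addv_ge0 c10 c20) c12).
move=> /le_trans /(_ nP); rewrite -lerBrDr => /le_trans; apply.
rewrite lerBlDr -natr1 mulrDl mul1r lerD2l ltW //.
exact: Ce.
Qed.

(** If W u is not zero, it fails to be below e X for some e > 0.  In the band of
    (W u - e X)^+ this failure is everywhere: no non-zero component of W u there
    is below e X.  As W commutes with band projections, the hypothesis of
    [atom_below] holds, and the atom that it gives contradicts the choice
    of u. *)
Lemma orth_dominated_eq0 (W : regop E E) X u : orthomorphism W -> 0 <= W ->
  0 <= X -> (forall y, 0 <= y -> W y <= psi y *: X) ->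
  0 <= u -> disjoint_complement (carrier (atomic_part E)) u -> W u = 0.
Proof.
move=> WO /regop_leP W0 X0 WX u0 du.
apply: le_anti; rewrite W0 // andbT.
apply: (archimedean X0) => e e0; set z := W u - e *: X.
suff r0 : vpos z = 0.
  by have := lev_joinl z 0; rewrite -/(vpos z) r0 levBlDr add0r.
apply/eqP; apply: contrapT => /negP rn0.
pose C := generated_band [set vpos z].
have [a aa au] : exists2 a, atom a & a <= u.
  apply: (@atom_below e u C) => //.
    by exists (vpos z) => //; exact: mem_generated_band.
  move=> C' C'C [x C'x xn0]; rewrite ltNge; apply/negP => psie.
  (* If psi were small on the component of u in C', then z <= 0 on C', while
     z coincides there with its positive part, which generates C. *)
  have Pz : band_proj C' z <= 0.
    rewrite linearB /= -orth_band_proj // levBlDr add0r.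
    have p0 := band_proj_ge0 C' u0.
    have WC' : carrier C' (W (band_proj C' u)).
      by have [_ WB] := WO; apply/WB/(band_projP C' u).1.
    rewrite -(band_proj_id WC'); apply: band_proj_incr.
    apply: (le_trans (WX _ p0)).
    by rewrite -subv_ge0 -scalerBl scalev_ge0 // subr_ge0.
  have Pn : band_proj C' (vneg z) = 0.
    apply: band_proj_eq0 => t /C'C Ct; apply: disjointC.
    by apply: generated_band_disjoint Ct; exact: disjoint_posneg.
  have Pr : band_proj C' (vpos z) = 0.
    apply: le_anti; rewrite band_proj_ge0 ?vpos_ge0 // andbT.
    by move: Pz; rewrite {1}[z]vposBneg linearB /= Pn subr0.
  have dr : disjoint_complement (carrier C') (vpos z).
    by rewrite -[vpos z]subr0 -Pr; exact: (band_projP C' _).2.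
  move/eqP: xn0; apply; apply: disjoint_self.
  by apply: generated_band_disjoint (C'C _ C'x); exact: dr.
have [/eqP an0 a0 _] := aa.
apply: an0; apply: disjoint_self.
apply: (@le_disjoint _ _ _ u); first by rewrite !ger0_absv.
by apply: du; apply: mem_generated_band.
Qed.

End domination.

(** * The moduli of functionals and operators *)

Section functional_modulus.
Variables (R : realType) (E : vectorLatticeType R) (phi : {linear E -> R^o}).
Hypothesis phi_bounded : order_bounded phi.
Implicit Types x y : E.

(** The Riesz-Kantorovich formula for the value at y >= 0 of the modulus of
    phi. *)
Definition functional_modulus y : R :=
  reals.sup [set (phi h : R) | h in [set h | - y <= h <= y]].

Let has_sup_values y : 0 <= y ->
  has_sup [set (phi h : R) | h in [set h | - y <= h <= y]].
Proof.
move=> y0; split.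
  exists (phi 0), 0 => //=.
  by rewrite y0 andbT -oppr0 levN2.
have [c [d cd]] := phi_bounded (- y) y.
by exists d => _ [h /cd /andP[_ hd] <-].
Qed.

Let le_modulus y h :
  0 <= y -> - y <= h <= y -> (phi h : R) <= functional_modulus y.
Proof.
move=> y0 hy; apply: (sup_upper_bound (has_sup_values y0)).
by exists h.
Qed.

Lemma functional_modulus_ge y : 0 <= y -> `|phi y : R| <= functional_modulus y.
Proof.
move=> y0; rewrite ler_norml lerNl.
have Ny : - y <= y by apply: (le_trans _ y0); rewrite -oppr0 levN2.
have -> : - (phi y : R) = phi (- y) by rewrite linearN.
by rewrite !le_modulus ?lexx ?Ny.
Qed.

Lemma functional_modulus_ge0 y : 0 <= y -> 0 <= functional_modulus y.
Proof. by move=> /functional_modulus_ge; exact: le_trans. Qed.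

Lemma functional_modulus_superadd x y : 0 <= x -> 0 <= y ->
  functional_modulus x + functional_modulus y <= functional_modulus (x + y).
Proof.
move=> x0 y0; rewrite -lerBrDr.
apply: ge_sup; first exact: (has_sup_values x0).1.
move=> _ [h /= /andP[xh hx] <-]; rewrite lerBrDl -lerBrDr.
apply: ge_sup; first exact: (has_sup_values y0).1.
move=> _ [k /= /andP[yk ky] <-]; rewrite lerBrDr.
have -> : (phi k : R) + phi h = phi (h + k) by rewrite linearD addrC.
apply: le_modulus; first exact: addv_ge0.
by rewrite opprD !levD.
Qed.

End functional_modulus.

Section operator_modulus.
Variables (R : realType) (E : vectorLatticeType R).
Variable F : completeVectorLatticeType R.
Implicit Types (T : regop E F) (x u : E).

Lemma regop_le_absv T x : 0 <= x -> T x <= absv T x /\ - T x <= absv T x.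
Proof.
move=> x0; split; first by have /regop_leP := ler_absv T; exact.
by have /regop_leP := lev_joinr T (- T) => /(_ x x0).
Qed.

Lemma regop_eq0_absv T x : 0 <= x -> absv T x = 0 -> T x = 0.
Proof.
move=> x0 Tx; have [h1 h2] := regop_le_absv T x0.
by apply: absv_eq0; rewrite vjoinP -{1}Tx h1 -Tx.
Qed.

(** A value of the modulus at x is the supremum of sums of vectors T u or - T u
    over decompositions of x, and a superadditive bound survives such sums. *)
Lemma absv_regop_le T (f : E -> F) :
  (forall u, 0 <= u -> absv (T u) <= f u) ->
  (forall x y, 0 <= x -> 0 <= y -> f x + f y <= f (x + y)) ->
  forall x, 0 <= x -> absv T x <= f x.
Proof.
move=> Tf fD x x0.
have sT : supremums [set T; - T] (absv T).
  split=> [_ [->|->]|U ub]; [exact: lev_joinl|exact: lev_joinr|].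
  by rewrite vjoinP !ub //; [right | left].
have [_ lub] : supremums (pieces [set T; - T] x) (absv T x).
  by apply: regop_sup => //; exists T; left.
apply: lub => z {x0}; elim=> [|{}x {}z U u xz IH UT u0].
  by apply: le_trans (Tf 0 _); rewrite ?absv_ge0.
apply: le_trans (fD _ _ (pieces_ge0 xz) u0); apply: levD => //.
apply: le_trans (Tf u u0).
by case: UT => ->; [exact: ler_absv | exact: lev_joinr].
Qed.

End operator_modulus.

(** * The diagonal outside the atomic part *)

Section off_atomic.
Variables (R : realType) (E : completeVectorLatticeType R).
Local Notation A := (atomic_part E).
Implicit Types (T S : regop E E) (x y : E).

Definition off_atomic_orth : set (regop E E) :=
  [set S | [/\ orthomorphism S, 0 <= S & forall x, carrier A x -> S x = 0]].

(** Crude, but it puts the coefficients in a single scalar in front of a vector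
    independent of them, as [orth_dominated_eq0] requires. *)
Lemma absv_scale_sum n (c : 'I_n -> R) (x : 'I_n -> E) :
  absv (\sum_i c i *: x i) <= (\sum_i `|c i|) *: (\sum_i absv (x i)).
Proof.
rewrite scaler_suml.
elim/big_ind2: _ => [|a b a' b' h h'|i _].
- by rewrite absv0.
- by apply: le_trans (absvD _ _) _; exact: levD.
apply: (le_trans (absvZ_le _ _)); apply: levZ2 => //.
rewrite (bigD1 i) //= -[X in X <= _]addr0; apply: levD2l.
by elim/big_ind: _ => // *; rewrite ?addv_ge0 ?absv_ge0.
Qed.

(** The meet W of S and the modulus of T is again in [off_atomic_orth], and the
    representation of T bounds W y by psi(y) X; so [orth_dominated_eq0] makes W
    vanish on the complement of the atomic part. *)
Lemma tensor_disjoint_off_atomic T :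
  tensor_oc_dual T -> disjoint_complement off_atomic_orth T.
Proof.
move=> [n [x [phi [phiN TE]]]] S [SO S0 SA].
have [[_ _ Osol] _] := @orthomorphism_band R E.
pose psi y := \sum_i functional_modulus (phi i) y.
pose X := \sum_i absv (x i).
have X0 : 0 <= X.
  by rewrite /X; elim/big_ind: _ => // *; rewrite ?addv_ge0 ?absv_ge0.
have psi_ge0 y : 0 <= y -> 0 <= psi y.
  move=> y0; apply: sumr_ge0 => i _.
  by apply: functional_modulus_ge0 => //; case: (phiN i).
have psiD y z : 0 <= y -> 0 <= z -> psi y + psi z <= psi (y + z).
  move=> y0 z0; rewrite -big_split; apply: ler_sum => i _.
  by apply: functional_modulus_superadd => //; case: (phiN i).
rewrite /vdisjoint (ger0_absv S0); set W := vmeet _ _.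
have W0 : 0 <= W by rewrite vmeet_ge0 ?absv_ge0.
have WS : W <= S by exact: lev_meetr.
have WO : orthomorphism W by apply: Osol SO _; rewrite !ger0_absv.
have WX y : 0 <= y -> W y <= psi y *: X.
  move=> y0; apply: (@le_trans _ _ (absv T y)).
    by have /regop_leP := lev_meetl (absv T) S; exact.
  apply: (@absv_regop_le _ _ _ T (fun y => psi y *: X)) => // [u u0|u v u0 v0].
    rewrite TE; apply: (le_trans (absv_scale_sum _ _)).
    rewrite -subv_ge0 -scalerBl scalev_ge0 // subr_ge0; apply: ler_sum => i _.
    by apply: functional_modulus_ge => //; case: (phiN i).
  by rewrite -scalerDl -subv_ge0 -scalerBl scalev_ge0 // subr_ge0 psiD.
apply: eq_regop => u u0; rewrite regop0.
have -> : W u = W (u - band_proj A u) + W (band_proj A u).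
  by rewrite -linearD subrK.
have -> : W (band_proj A u) = 0.
  have p0 := band_proj_ge0 A u0.
  apply: le_anti; move/regop_leP: W0 => ->; rewrite // andbT.
  rewrite -(SA _ (band_projP A u).1); by move/regop_leP: WS; exact.
rewrite addr0; apply: (orth_dominated_eq0 psi_ge0 psiD WO W0 X0 WX).
  by rewrite subv_ge0 band_proj_le.
exact: (band_projP A u).2.
Qed.

Lemma integral_disjoint_off_atomic T :
  abstract_integral_operator T -> disjoint_complement off_atomic_orth T.
Proof.
apply: (@sub_generated_band _ _ _ (complement_band off_atomic_orth)).
exact: tensor_disjoint_off_atomic.
Qed.

(** With D the diagonal of T, the operator S = |D| (I - P) belongs to
    [off_atomic_orth].  It is disjoint from T by integrality and from T - D because
    it is an orthomorphism, hence from D; but S <= |D|. *)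
Lemma op_diagonal_off_atomic T x : abstract_integral_operator T ->
  disjoint_complement (carrier A) x -> op_diagonal T x = 0.
Proof.
move=> /integral_disjoint_off_atomic TH.
have [DO dD] := band_projP (Orth E) T; rewrite -/(op_diagonal T) in DO dD *.
set D := op_diagonal T in DO dD *.
have [[_ _ Osol] _] := @orthomorphism_band R E.
have [_ aDB] : orthomorphism (absv D) by apply: Osol DO _; rewrite absv_absv.
have /regop_leP aD0 := absv_ge0 D.
pose Ad := complement_band (carrier A).
have Sp : positive_operator (absv D \o band_proj Ad).
  by move=> y y0 /=; apply/aD0/band_proj_ge0.
pose S : regop E E := Regop (pos_regopP Sp).
have SE y : S y = absv D (band_proj Ad y) by [].
have S0 : 0 <= S by apply/regop_leP => y /Sp.
have SD : S <= absv D.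
  apply/regop_leP => y y0; rewrite SE.
  by apply: regop_incr; [exact: absv_ge0 | exact: band_proj_le].
have SO : orthomorphism S.
  apply: (Osol _ D DO); by rewrite ger0_absv.
have SH : off_atomic_orth S.
  split=> // y Ay; rewrite SE band_proj_complement band_proj_id // subrr.
  exact: linear0.
have SD0 : vdisjoint D S.
  rewrite -[D](subKr T) -scaleN1r addrC; apply: disjointD; last exact: TH.
  by apply: disjointZ; exact: dD.
have {}S0 : S = 0.
  apply: disjoint_self; apply: le_disjoint SD0; by rewrite (ger0_absv S0).
have pos y : 0 <= y -> disjoint_complement (carrier A) y -> D y = 0.
  move=> y0 dy; apply: regop_eq0_absv => //.
  by rewrite -(@band_proj_id _ _ Ad y dy) -SE S0.
move=> dx; have [[_ _ Adsol] _] := bandP Ad.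
rewrite [x]vposBneg linearB /= !pos ?subr0 ?vpos_ge0 ?vneg_ge0 //.
  apply: Adsol dx _.
  by rewrite ger0_absv ?vneg_ge0 // vjoinP lev_joinr absv_ge0.
by apply: Adsol dx _; rewrite ger0_absv ?vpos_ge0 // vjoinP ler_absv absv_ge0.
Qed.

End off_atomic.

(** * Compression to a band and the diagonal *)

Section band_lattice.
Variables (R : realType) (E : completeVectorLatticeType R) (B : band E).
Local Notation BT := (band_type B).
Implicit Types (b c : BT) (C : band E) (G : band BT).

Lemma val_absv b : val (absv b) = absv (val b).
Proof. by []. Qed.

Lemma carrier_le x y : carrier B y -> absv x <= absv y -> carrier B x.
Proof. by have [[_ _ Bsol] _] := bandP B => By; exact: Bsol. Qed.

(** The point is that suprema computed inside B are suprema in E: B contains the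
    supremum in E of each of its subsets that has one. *)
Lemma trace_is_band C : is_band [set b : BT | carrier C (val b)].
Proof.
have [[C0 Clin Csol] Csup] := bandP C; split; first split.
- exact: C0.
- by move=> a b c Cb Cc /=; apply: Clin.
- by move=> b c /= Cc; rewrite lev_val !val_absv; exact: Csol.
move=> D s DC sD.
have [D0|/set0P[d0 Dd0]] := eqVneq D set0.
  by move: sD; rewrite D0 => /supremums_set0 ->; exact: C0.
have [ub lub] := sD.
pose D' := [set val d | d in D].
have sD' : has_sup D'.
  split; first by exists (val d0), d0.
  by exists (val s) => _ [d Dd <-]; rewrite -lev_val; exact: ub.
have [ub' lub'] := vsupP sD'.
have [_ Bsup] := bandP B.
have Bt : carrier B (vsup D').
  by apply: (Bsup D'); [move=> _ [d _ <-]; exact: carrier_val | exact: vsupP].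
have -> : s = to_band Bt.
  apply: le_anti; apply/andP; split.
    by apply: lub => d Dd; rewrite lev_val; apply: ub'; exists d.
  rewrite lev_val; apply: lub' => _ [d Dd <-].
  by rewrite -lev_val; exact: ub.
by apply: (Csup D') => /=; [move=> _ [d Dd <-]; exact: DC | exact: vsupP].
Qed.

Lemma image_is_band G : is_band [set val b | b in carrier G].
Proof.
have [[G0 Glin Gsol] Gsup] := bandP G; split; first split.
- by exists 0.
- by move=> a _ _ [b Gb <-] [c Gc <-]; exists (a *: b + c) => //; exact: Glin.
- move=> x _ [c Gc <-] xc.
  exists (to_band (carrier_le (carrier_val c) xc)) => //.
  by apply: Gsol Gc _; rewrite lev_val.
move=> D s DG [ub lub].
have Bs : carrier B s.
  have [_ Bsup] := bandP B; apply: (Bsup D) => //.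
  by move=> x /DG [b _ <-]; exact: carrier_val.
exists (to_band Bs) => //; apply: (Gsup [set b | D (val b)]).
  by move=> b /= /DG [c Gc /val_inj <-].
split=> [b Db|c ubc]; rewrite lev_val /=; first exact: ub.
apply: lub => x Dx; have [b Gb bx] := DG _ Dx.
by rewrite -bx -lev_val; apply: ubc; rewrite /= bx.
Qed.

Lemma extension_orth (S : regop BT BT) :
  orthomorphism S -> orthomorphism (extension S).
Proof.
move=> [_ SB]; split; first exact: regop_order_bounded.
move=> C x Cx; apply: (SB (Band (trace_is_band C))).
by have [[_ _ Csol] _] := bandP C; apply: Csol Cx _; exact: absv_band_proj.
Qed.

Lemma compression_orth (T : regop E E) :
  orthomorphism T -> orthomorphism (compression B T).
Proof.
move=> [_ TB]; split; first exact: regop_order_bounded.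
move=> G b Gb.
have [c Gc cE] : [set val b | b in carrier G] (T (val b)).
  by apply: (TB (Band (image_is_band G))); exists b.
suff -> : compression B T b = c by [].
by apply: val_inj; rewrite /= -cE band_proj_id //; exact: carrier_val.
Qed.

Lemma compression_incr (T U : regop E E) :
  T <= U -> compression B T <= compression B U.
Proof.
move=> /regop_leP TU; apply/regop_leP => b b0; rewrite lev_val /=.
by apply/band_proj_incr/TU; rewrite lev_val in b0.
Qed.

Lemma compressionB (T U : regop E E) :
  compression B (T - U) = compression B T - compression B U.
Proof.
apply: eq_regop => b _; apply: val_inj.
rewrite raddfB /=; exact: linearB.
Qed.

Lemma compressionN (T : regop E E) : compression B (- T) = - compression B T.
Proof.
by apply: eq_regop => b _; apply: val_inj; rewrite raddfN /=; exact: linearN.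
Qed.

Lemma absv_compression (T : regop E E) :
  absv (compression B T) <= compression B (absv T).
Proof.
by rewrite vjoinP -compressionN !compression_incr ?lev_joinl ?lev_joinr.
Qed.

(** P T P <= T P <= T when T is positive. *)
Lemma extension_compression_le (T : regop E E) :
  0 <= T -> extension (compression B T) <= T.
Proof.
move=> T0; apply/regop_leP => x x0 /=.
have p0 := band_proj_ge0 B x0.
apply: (@le_trans _ _ (T (band_proj B x))).
  by apply: band_proj_le; move/regop_leP: T0; apply.
by apply: regop_incr => //; exact: band_proj_le.
Qed.

Lemma extension_incr (S U : regop BT BT) : S <= U -> extension S <= extension U.
Proof.
move=> /regop_leP SU; apply/regop_leP => x x0 /=; rewrite -lev_val.
exact/SU/to_band_proj_ge0.
Qed.

Lemma extension_val (S : regop BT BT) b : extension S (val b) = val (S b).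
Proof.
rewrite /=; congr (val (S _)); apply: val_inj.
by rewrite /= band_proj_id //; exact: carrier_val.
Qed.

(** What has to be shown is that U = T - D, disjoint from Orth(E), has a
    compression disjoint from each S in Orth(B).  The meet W of S and the modulus
    of the compression extends to an orthomorphism of E below P |U| P <= |U|; being
    disjoint from U, this extension is zero. *)
Lemma op_diagonal_compression (T : regop E E) :
  op_diagonal (compression B T) = compression B (op_diagonal T).
Proof.
have [DO dD] := band_projP (Orth E) T; rewrite -/(op_diagonal T) in DO dD.
apply: band_proj_unique; first exact: compression_orth.
rewrite -compressionB; set U := T - _ in dD *.
move=> S SO; rewrite /vdisjoint; set W := vmeet _ _.
have W0 : 0 <= W by rewrite vmeet_ge0 ?absv_ge0.
have WO : orthomorphism W.
  have [[_ _ Osol] _] := orthomorphism_band BT.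
  by apply: Osol SO _; rewrite (ger0_absv W0); exact: lev_meetr.
have eW0 : 0 <= extension W.
  apply/regop_leP => x x0 /=.
  have /regop_leP /(_ _ (to_band_proj_ge0 B x0)) := W0.
  by rewrite lev_val.
have eWU : extension W <= absv U.
  apply: le_trans (extension_compression_le (absv_ge0 U)).
  by apply/extension_incr/(le_trans (lev_meetl _ _))/absv_compression.
have eWE : extension W = 0.
  apply: disjoint_self; apply: (@le_disjoint _ _ _ U).
    by rewrite ger0_absv.
  exact/dD/extension_orth.
by apply: eq_regop => b _; apply: val_inj; rewrite -extension_val eWE.
Qed.

End band_lattice.

Theorem theorem4p4 (R : realType) (E : completeVectorLatticeType R)
    (T : regop E E) :
  abstract_integral_operator T ->
  op_diagonal T = band_diagonal (atomic_part E) T.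
Proof.
move=> Tint; rewrite /band_diagonal op_diagonal_compression.
have [[_ DB] _] := band_projP (Orth E) T; rewrite -/(op_diagonal T) in DB.
apply: eq_regop => x _ /=.
have [Ax dx] := band_projP (atomic_part E) x.
rewrite (band_proj_id (DB _ _ Ax)).
have /eqP := op_diagonal_off_atomic Tint dx.
by rewrite linearB subr_eq0 => /eqP.
Qed.
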